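(* Let $n$ be an integer with $3\le n<\infty$, and let $A=\mathrm{IDD}(K^1_n,1,-1)$ be the complex algebra with basis $e_1,\ldots,e_n$ and bilinear multiplication $e_i\diamond e_j=\frac{i}{j+1}e_{i+j}$ if $i+j\le n$, and $e_i\diamond e_j=0$ otherwise. Then the space of derivations of $A$ is $$\mathfrak{Der}(A)=\langle\varphi,\ \phi_1,\ \phi_2\rangle,$$ where these linear maps are given on the basis (all values not listed being zero) by - $\varphi(e_i)=i\,e_i$ for $1\le i\le n$; - $\phi_1(e_1)=n\,e_{n-1}$, $\ \phi_1(e_2)=(n^2-n+2)\,e_n$; - $\phi_2(e_1)=e_n$.
   Context: A derivation of an algebra $(A,\diamond)$ is a linear map $D:A\to A$ with $D(a\diamond b)=D(a)\diamond b+a\diamond D(b)$ for all $a,b\in A$. $\langle S\rangle$ denotes the linear span of $S$ over $\mathbb C$. *)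

(* Defs.v *)
From HB Require Import structures.
From mathcomp Require Import all_boot all_order all_algebra.
From mathcomp Require Import boolp classical_sets reals.
From mathcomp Require Export complex.

Set Implicit Arguments.
Unset Strict Implicit.
Unset Printing Implicit Defensive.

Import Order.TTheory GRing.Theory Num.Theory.

Local Open Scope ring_scope.

Section Derivations.
Variables (F : fieldType) (V : vectType F).

Definition is_derivation (mul : V -> V -> V) (D : 'End(V)) : Prop :=
  forall a b : V, D (mul a b) = mul (D a) b + mul a (D b).

Definition Der (mul : V -> V -> V) : set 'End(V) :=
  [set D : 'End(V) | is_derivation mul D]%classic.

End Derivations.

Section IDD.
Variables (F : fieldType) (n : nat).

(* The basis is numbered from 1: [ebasis k] is the (k-1)-th standard row vector
   for 1 <= k <= n, and 0 for every other k. *)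
Definition ebasis (k : nat) : 'rV[F]_n := \row_(j < n) (j.+1 == k)%:R.

Definition idd_basis_mul (i j : nat) : 'rV[F]_n :=
  if (i + j <= n)%N then (i%:R / j.+1%:R) *: ebasis (i + j) else 0.

Definition idd_mul (x y : 'rV[F]_n) : 'rV[F]_n :=
  \sum_(i < n) \sum_(j < n) (x 0 i * y 0 j) *: idd_basis_mul i.+1 j.+1.

(* Row vectors are multiplied on the right by the matrix with rows
   g 1, ..., g n, so this is the linear map sending e_k to g k. *)
Definition lin_ext (g : nat -> 'rV[F]_n) : 'End('rV[F]_n) :=
  linfun (mulmxr (\matrix_(i < n) g i.+1)).

Definition varphi : 'End('rV[F]_n) := lin_ext (fun i => i%:R *: ebasis i).

Definition phi1 : 'End('rV[F]_n) :=
  lin_ext (fun i =>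
    if i == 1%N then n%:R *: ebasis n.-1
    else if i == 2%N then (n%:R ^+ 2 - n%:R + 2) *: ebasis n
    else 0).

Definition phi2 : 'End('rV[F]_n) :=
  lin_ext (fun i => if i == 1%N then ebasis n else 0).

Lemma ebasisE (i : 'I_n) : ebasis i.+1 = delta_mx 0 i.
Proof. by apply/rowP => j; rewrite !mxE eqxx eqSS. Qed.

Lemma lin_ext_ebasis g k : (1 <= k <= n)%N -> lin_ext g (ebasis k) = g k.
Proof.
case: k => // k /= ltkn; rewrite (ebasisE (Ordinal ltkn)) lfunE /= -rowE.
exact: rowK.
Qed.

Lemma idd_mul_ebasis i j : (1 <= i <= n)%N -> (1 <= j <= n)%N ->
  idd_mul (ebasis i) (ebasis j) = idd_basis_mul i j.
Proof.
case: i j => [|i] [|j] //= lti ltj; rewrite /idd_mul.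
rewrite (bigD1 (Ordinal lti)) //= (bigD1 (Ordinal ltj)) //= !mxE !eqxx mulr1.
rewrite scale1r !big1 ?addr0 // => [i' ne_i | j' ne_j].
  apply: big1 => j' _; rewrite !mxE eqSS.
  by move: ne_i; rewrite -val_eqE /= => /negPf->; rewrite mul0r scale0r.
rewrite !mxE !eqSS.
by move: ne_j; rewrite -val_eqE /= => /negPf->; rewrite mulr0 scale0r.
Qed.

End IDD.

Arguments ebasis {F n} k.

(* Main.v *)
From HB Require Import structures.
Require Import Defs.
From mathcomp Require Import all_boot all_order all_algebra.
From mathcomp Require Import boolp classical_sets reals complex.
From mathcomp Require Import ring zify.

(** Since [e_1 <> e_j = e_(j+1) / (j+1)], the algebra is generated by [e_1], so
    a derivation is determined by its value at [e_1]
    ([derivation_eq0_of_e1]).  That value is constrained by the two factorizations of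
    [e_3], namely [e_3 = 3 (e_1 <> e_2)] and [e_3 = e_2 <> e_1].  If
    [D e_1 = \sum_k a_k e_k], then [D e_2 = 2 D (e_1 <> e_1)] is known, and
    comparing the coefficients of [e_(k+2)] in the two resulting expressions
    for [D e_3] gives, after clearing denominators,
      [k (k - 1) (k^2 + 3 k - 2) a_k = 0]   whenever [k + 2 <= n].
    The factor is nonzero for [k >= 2] in characteristic 0, so
    [D e_1] is a combination of [e_1], [e_(n-1)] and [e_n]
    ([derivation_coef_eq0]).

    Conversely [varphi], [phi1] and [phi2] are derivations, and they send [e_1]
    to [e_1], [n e_(n-1)] and [e_n].  Hence a suitable combination of them
    agrees with [D] at [e_1], and the difference, a derivation that vanishes at
    the generator, is zero. *)

Set Implicit Arguments.
Unset Strict Implicit.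
Unset Printing Implicit Defensive.

Import Order.TTheory GRing.Theory Num.Theory.

Local Open Scope ring_scope.

(** * The multiplication in coordinates and on the basis *)

Section Multiplication.
Variables (F : numFieldType) (n : nat).
Implicit Types (x y : 'rV[F]_n) (D : 'End('rV[F]_n)).

Local Notation mul := (@idd_mul F n).
Local Notation e k := (ebasis k : 'rV[F]_n).

Lemma ebasis_gt k : (n < k)%N -> e k = 0.
Proof.
move=> ltnk; apply/rowP => j; rewrite !mxE; case: eqP => // jk.
by have := ltn_ord j; lia.
Qed.

Lemma rV_ebasis x : x = \sum_(i < n) x 0 i *: e i.+1.
Proof.
by rewrite [LHS]row_sum_delta; apply: eq_bigr => i _; rewrite ebasisE.
Qed.

Lemma idd_mul_is_linear x : linear (mul x).
Proof.
move=> c y z; rewrite /idd_mul scaler_sumr -big_split; apply: eq_bigr => i _.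
rewrite scaler_sumr -big_split; apply: eq_bigr => j _ /=.
by rewrite !mxE scalerA -scalerDl; congr (_ *: _); ring.
Qed.

HB.instance Definition _ x :=
  GRing.isLinear.Build F 'rV[F]_n 'rV[F]_n *:%R (mul x) (idd_mul_is_linear x).

Definition idd_mulr y x := mul x y.

Lemma idd_mulr_is_linear y : linear (idd_mulr y).
Proof.
move=> c x z; rewrite /idd_mulr /idd_mul scaler_sumr -big_split.
apply: eq_bigr => i _; rewrite scaler_sumr -big_split; apply: eq_bigr => j _ /=.
by rewrite !mxE scalerA -scalerDl; congr (_ *: _); ring.
Qed.

HB.instance Definition _ y :=
  GRing.isLinear.Build F 'rV[F]_n 'rV[F]_n *:%R (idd_mulr y)
    (idd_mulr_is_linear y).

Lemma idd_mulZl c x y : mul (c *: x) y = c *: mul x y.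
Proof. exact: (linearZZ (idd_mulr y)). Qed.

Lemma idd_mulDl x z y : mul (x + z) y = mul x y + mul z y.
Proof. exact: (linearD (idd_mulr y)). Qed.

Lemma idd_mul0l y : mul 0 y = 0.
Proof. exact: (linear0 (idd_mulr y)). Qed.

Lemma idd_mul_suml (I : finType) (x : I -> 'rV[F]_n) y :
  mul (\sum_i x i) y = \sum_i mul (x i) y.
Proof. exact: (linear_sum (idd_mulr y)). Qed.

Lemma idd_mulDr x y z : mul x (y + z) = mul x y + mul x z.
Proof. exact: (linearD (mul x)). Qed.

Lemma idd_mul0r x : mul x 0 = 0.
Proof. exact: (linear0 (mul x)). Qed.

Lemma idd_mulZr c x y : mul x (c *: y) = c *: mul x y.
Proof. exact: (linearZZ (mul x)). Qed.

Lemma idd_mul_sumr (I : finType) x (y : I -> 'rV[F]_n) :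
  mul x (\sum_i y i) = \sum_i mul x (y i).
Proof. exact: (linear_sum (mul x)). Qed.

(** The product rule holds without a truncation clause because
    [e_k = 0] for [k > n].  It fails for [j = 0], where [e_0 = 0] but the
    right-hand side is [i e_i]. *)
Lemma mul_ebasis i j : (0 < j)%N ->
  mul (e i) (e j) = (i%:R / j.+1%:R) *: e (i + j).
Proof.
move=> j0; case: (posnP i) => [->|i0].
  rewrite mul0r scale0r; have -> : e 0 = 0 by apply/rowP => k; rewrite !mxE.
  exact: idd_mul0l.
have [ltni|lein] := ltnP n i.
  by rewrite ebasis_gt // idd_mul0l ebasis_gt ?scaler0 //; lia.
have [ltnj|lejn] := ltnP n j.
  by rewrite (ebasis_gt ltnj) linear0 ebasis_gt ?scaler0 //; lia.
rewrite idd_mul_ebasis ?i0 ?j0 // /idd_basis_mul; case: leqP => // ltn.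
by rewrite ebasis_gt ?scaler0.
Qed.

(** Since coordinates are numbered from 0, the coordinate [m] is the
    coefficient of [e_(m+1)]. *)
Lemma mul_ebasis_l i y (m k : 'I_n) : (k = i + m :> nat)%N ->
  mul (e i) y 0 k = i%:R / m.+2%:R * y 0 m.
Proof.
move=> km; rewrite {1}(rV_ebasis y) linear_sum summxE (bigD1 m) //= big1.
  by rewrite addr0 linearZ /= mul_ebasis // !mxE km addnS eqxx mulr1 mulrC.
move=> j; rewrite -val_eqE /= => neq.
rewrite linearZ /= mul_ebasis // !mxE km.
by rewrite addnS eqSS eqn_add2l eq_sym (negPf neq) !mulr0.
Qed.

Lemma mul_ebasis_r j y (m k : 'I_n) : (0 < j)%N -> (k = m + j :> nat)%N ->
  mul y (e j) 0 k = m.+1%:R / j.+1%:R * y 0 m.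
Proof.
move=> j0 km; rewrite {1}(rV_ebasis y) idd_mul_suml summxE (bigD1 m) //= big1.
  by rewrite addr0 idd_mulZl mul_ebasis // !mxE km addSn eqxx mulr1 mulrC.
move=> i; rewrite -val_eqE /= => neq.
rewrite idd_mulZl mul_ebasis // !mxE km.
by rewrite addSn eqSS eqn_add2r eq_sym (negPf neq) !mulr0.
Qed.

(** * Derivations are determined by their value at the generator *)

Lemma End_eq0_ebasis D : (forall k, (0 < k)%N -> D (e k) = 0) -> D = 0.
Proof.
move=> De0; apply/lfunP => x; rewrite lfunE /= (rV_ebasis x) linear_sum.
by apply: big1 => i _; rewrite linearZ /= De0 // scaler0.
Qed.

Lemma is_derivation_ebasis D :
    (forall i j, (0 < i)%N -> (0 < j)%N ->
       D (mul (e i) (e j)) = mul (D (e i)) (e j) + mul (e i) (D (e j))) ->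
  is_derivation mul D.
Proof.
move=> Dbasis x y; rewrite (rV_ebasis x) (rV_ebasis y).
rewrite idd_mul_suml !(linear_sum D) !idd_mul_suml -big_split.
apply: eq_bigr => i _ /=.
rewrite !idd_mul_sumr (linear_sum D) -big_split; apply: eq_bigr => j _ /=.
rewrite !(idd_mulZl, idd_mulZr, linearZZ D) /= Dbasis // !scalerDr.
by congr (_ + _); rewrite !scalerA mulrC.
Qed.

Lemma is_derivation_comb c D D' : is_derivation mul D -> is_derivation mul D' ->
  is_derivation mul (c *: D + D').
Proof.
move=> dD dD' x y; rewrite !add_lfunE !scale_lfunE dD dD'.
by rewrite idd_mulDl idd_mulZl idd_mulDr idd_mulZr scalerDr addrACA.
Qed.

Lemma natS_neq0 k : k.+1%:R != 0 :> F.
Proof. by rewrite pnatr_eq0. Qed.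

Lemma ebasisS k : (0 < k)%N -> e k.+1 = k.+1%:R *: mul (e 1) (e k).
Proof.
by move=> k0; rewrite mul_ebasis // scalerA mul1r mulfV ?natS_neq0 ?scale1r.
Qed.

Lemma derivation_eq0_of_e1 D : is_derivation mul D -> D (e 1) = 0 -> D = 0.
Proof.
move=> dD De1; apply: End_eq0_ebasis; case=> // k _.
elim: k => // k IH.
by rewrite ebasisS // (linearZZ D) /= dD De1 IH idd_mul0l idd_mul0r addr0 scaler0.
Qed.

(** * The constraint on the value at the generator *)

(** The two factorizations of [e_3] give [k (k - 1) (k^2 + 3 k - 2) a_k = 0]
    with [k = m + 1]; here [m >= 1] and [k + 2 <= n]. *)
Lemma derivation_coef_eq0 D (m : 'I_n) : is_derivation mul D ->
  (0 < m)%N -> (m + 2 < n)%N -> D (e 1) 0 m = 0.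
Proof.
move=> dD m0 ltmn.
have ltm1 : (m.+1 < n)%N by lia.
have ltm2 : (m.+2 < n)%N by lia.
pose m1 := Ordinal ltm1; pose m2 := Ordinal ltm2.
have e12 : 3%:R *: mul (e 1) (e 2) = mul (e 2) (e 1).
  by rewrite -ebasisS // mul_ebasis // mulfV ?natS_neq0 // scale1r.
have : 3%:R *: (mul (D (e 1)) (e 2) + mul (e 1) (D (e 2)))
    = mul (D (e 2)) (e 1) + mul (e 2) (D (e 1)).
  by rewrite -!dD -e12 (linearZZ D).
move=> /rowP/(_ m2); rewrite !mxE.
rewrite (@mul_ebasis_r 2 _ m m2) ?(@mul_ebasis_l 1 _ m1 m2) //=; last by lia.
rewrite (@mul_ebasis_r 1 _ m1 m2) ?(@mul_ebasis_l 2 _ m m2) //=; last by lia.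
rewrite (@ebasisS 1) // (linearZZ D) /= dD !mxE.
rewrite (@mul_ebasis_r 1 _ m m1) ?(@mul_ebasis_l 1 _ m m1) //=; last by lia.
set a := D _ 0 m => E.
have fac : (m.+1 * m * (m ^ 2 + 5 * m + 2))%:R * a = 0.
  move: E (natS_neq0 m.+1) (natS_neq0 m.+2); rewrite !(natrM, natrD, natrX).
  rewrite -(addn3 m) -(addn2 m) -(addn1 m) !natrD; set t := m%:R.
  move=> /eqP; rewrite -subr_eq0 => /eqP E t2 t3.
  (* [- 2 (t + 2) (t + 3)] clears the denominators of [E]. *)
  by rewrite -(mulr0 (- 2 * (t + 2) * (t + 3))) -E; field; rewrite t2 t3.
move/eqP: fac; rewrite mulf_eq0 pnatr_eq0 => /orP[|/eqP //].
by rewrite !muln_eq0; lia.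
Qed.

(** * The three derivations *)

Lemma varphi_ebasis k : (0 < k)%N -> varphi F n (e k) = k%:R *: e k.
Proof.
move=> k0; have [lekn|ltnk] := leqP k n.
  by rewrite lin_ext_ebasis ?k0.
by rewrite ebasis_gt // linear0 scaler0.
Qed.

Lemma phi2_ebasis k : (0 < k)%N ->
  phi2 F n (e k) = if k == 1%N then e n else 0.
Proof.
move=> k0; have [lekn|ltnk] := leqP k n.
  by rewrite lin_ext_ebasis ?k0.
rewrite ebasis_gt // linear0; case: eqP => // k1.
by rewrite (_ : n = 0)%N; [apply/rowP => j; rewrite !mxE | lia].
Qed.

Lemma phi1_ebasis k : (1 < n)%N -> (0 < k)%N ->
  phi1 F n (e k) = if k == 1%N then n%:R *: e n.-1
    else if k == 2 then (n%:R ^+ 2 - n%:R + 2) *: e n else 0.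
Proof.
move=> n1 k0; have [lekn|ltnk] := leqP k n.
  by rewrite lin_ext_ebasis ?k0.
by rewrite ebasis_gt // linear0 !gtn_eqF //; lia.
Qed.

Lemma varphi_derivation : is_derivation mul (varphi F n).
Proof.
apply: is_derivation_ebasis => i j i0 j0.
rewrite !varphi_ebasis // idd_mulZl idd_mulZr mul_ebasis //.
rewrite (linearZZ (varphi F n)) /=.
rewrite varphi_ebasis ?addn_gt0 ?i0 // !scalerA -scalerDl natrD.
by congr (_ *: _); ring.
Qed.

Lemma phi2_derivation : is_derivation mul (phi2 F n).
Proof.
apply: is_derivation_ebasis => i j i0 j0.
rewrite !phi2_ebasis // mul_ebasis // (linearZZ (phi2 F n)) /=.
rewrite phi2_ebasis ?addn_gt0 ?i0 //.
rewrite (_ : (i + j == 1)%N = false) ?scaler0; last by lia.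
have [n0|n_gt0] := posnP n; first by apply/rowP => k; have := ltn_ord k; lia.
have -> : mul (if i == 1%N then e n else 0) (e j) = 0.
  by case: eqP => _; rewrite ?idd_mul0l // mul_ebasis //
    ebasis_gt ?scaler0 //; lia.
have -> : mul (e i) (if j == 1%N then e n else 0) = 0.
  by case: eqP => _; rewrite ?idd_mul0r // mul_ebasis //
    ebasis_gt ?scaler0 //; lia.
by rewrite addr0.
Qed.

(** [phi1] raises degrees by [n - 2], so only [e_1 <> e_1 = e_2 / 2] is not sent to 0 by both
    sides, and there the coefficient of [phi1 e_2] is forced by
    [(n^2 - n + 2) / 2 = n ((n - 1) / 2 + 1 / n)]. *)
Lemma phi1_derivation : (2 < n)%N -> is_derivation mul (phi1 F n).
Proof.
move=> n2; apply: is_derivation_ebasis => i j i0 j0.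
have n1_gt0 : (0 < n.-1)%N by lia.
have z k : (n < k)%N -> e k = 0 by exact: ebasis_gt.
have n1 : (1 < n)%N by lia.
rewrite !phi1_ebasis // mul_ebasis // (linearZZ (phi1 F n)) /=.
rewrite phi1_ebasis ?addn_gt0 ?i0 //.
rewrite (_ : (i + j == 1)%N = false); last by lia.
have [/andP[/eqP-> /eqP->]|ij] := boolP ((i == 1%N) && (j == 1%N)).
  rewrite /= idd_mulZl idd_mulZr !mul_ebasis // addn1 add1n prednK; last by lia.
  rewrite !scalerA -scalerDl; congr (_ *: _).
  have nn : n%:R != 0 :> F by rewrite pnatr_eq0; lia.
  have : n%:R = n.-1%:R + 1 :> F by rewrite natr1 prednK //; lia.
  move: nn; move: (n%:R) (n.-1%:R) => a b + ab; rewrite {}ab => nn.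
  by field.
have -> : (i + j == 2)%N = false by lia.
rewrite scaler0.
have -> : mul (if i == 1%N then n%:R *: e n.-1
    else if i == 2 then (n%:R ^+ 2 - n%:R + 2) *: e n else 0) (e j) = 0.
  by case: eqP => ?; [|case: eqP => ?]; rewrite ?idd_mul0l // idd_mulZl
    mul_ebasis // z ?scaler0 //; lia.
have -> : mul (e i) (if j == 1%N then n%:R *: e n.-1
    else if j == 2 then (n%:R ^+ 2 - n%:R + 2) *: e n else 0) = 0.
  by case: eqP => ?; [|case: eqP => ?]; rewrite ?idd_mul0r // idd_mulZr
    mul_ebasis ?z ?scaler0 //; lia.
by rewrite addr0.
Qed.

(** * The span *)

Lemma span3P (K : fieldType) (V : vectType K) (u v w x : V) :
  reflect (exists a b c, x = a *: u + (b *: v + c *: w))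
          (x \in <<[:: u; v; w]>>%VS).
Proof.
rewrite !span_cons span_nil addv0; apply: (iffP memv_addP).
  move=> [_ /vlineP[a ->] [_ /memv_addP[_ /vlineP[b ->] [_ /vlineP[c ->] ->]] ->]].
  by exists a, b, c.
move=> [a [b [c ->]]]; exists (a *: u); first by apply/vlineP; exists a.
exists (b *: v + c *: w) => //.
by apply: memv_add; apply/vlineP; eexists.
Qed.

(** What survives of [D e_1] after [derivation_coef_eq0], which kills the
    coefficients of [e_2], ..., [e_(n-2)]. *)
Lemma derivation_e1 D : (2 < n)%N -> is_derivation mul D ->
  exists a b c, D (e 1) = a *: e 1 + (b *: e n.-1 + c *: e n).
Proof.
move=> n2 dD.
have lt0 : (0 < n)%N by lia.
have lt1 : (n.-2 < n)%N by lia.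
have lt2 : (n.-1 < n)%N by lia.
exists (D (e 1) 0 (Ordinal lt0)), (D (e 1) 0 (Ordinal lt1)),
  (D (e 1) 0 (Ordinal lt2)).
apply/rowP => m; rewrite !mxE.
have coef k (ltk : (k < n)%N) : D (e 1) 0 (Ordinal ltk) * (m.+1 == k.+1)%:R
    = if m == k :> nat then D (e 1) 0 m else 0.
  rewrite eqSS; case: eqP => [mk|]; last by rewrite mulr0.
  by rewrite mulr1; congr (D _ 0 _); apply: val_inj.
have -> : (m.+1 == n.-1) = (m.+1 == n.-2.+1) by lia.
have -> : (m.+1 == n) = (m.+1 == n.-1.+1) by lia.
(* As [3 <= n], the indices 1, n - 1 and n are distinct, so no coordinate is
   counted twice. *)
rewrite !coef; have := ltn_ord m; do 3!case: eqP => /= ?;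
  rewrite ?(addr0, add0r) //; try lia.
by move=> ?; apply: derivation_coef_eq0 => //; lia.
Qed.

Lemma comb_derivation a b c : (2 < n)%N ->
  is_derivation mul
    (a *: varphi F n + (b *: phi1 F n + c *: phi2 F n)).
Proof.
move=> n2; rewrite -[c *: _]addr0.
apply: is_derivation_comb; first exact: varphi_derivation.
apply: is_derivation_comb; first exact: phi1_derivation.
apply: is_derivation_comb; first exact: phi2_derivation.
by move=> x y; rewrite !zero_lfunE idd_mul0l idd_mul0r addr0.
Qed.

(** The coefficient [b] of [e_(n-1)] in [D e_1] is divided by [n] because
    [phi1 e_1 = n e_(n-1)]. *)
Lemma Der_iddE : (2 < n)%N ->
  Der mul = [set D | D \in <<[:: varphi F n; phi1 F n; phi2 F n]>>%VS]%classic.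
Proof.
move=> n2; apply/funext => D; apply/propext; split=> [dD|/span3P[a [b [c ->]]]].
- apply/span3P; have [a [b [c De1]]] := derivation_e1 n2 dD.
  have nn : n%:R != 0 :> F by rewrite pnatr_eq0; lia.
  exists a, (b / n%:R), c.
  apply/eqP; rewrite eq_sym -subr_eq0 -[X in _ - X]scale1r -scaleNr addrC.
  apply/eqP; apply: derivation_eq0_of_e1.
    by apply: is_derivation_comb => //; exact: comb_derivation.
  rewrite !(add_lfunE, scale_lfunE) De1.
  rewrite varphi_ebasis // phi1_ebasis ?phi2_ebasis //=; last by lia.
  by rewrite scale1r scalerA divfK // scaleN1r addNr.
- exact: comb_derivation.
Qed.

End Multiplication.

Theorem theorem4p14 (R : realType) (n : nat) (hn : (3 <= n)%N) :
  Der (@idd_mul R[i] n)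
  = [set D : 'End('rV[R[i]]_n) |
      D \in <<[:: varphi R[i] n; phi1 R[i] n; phi2 R[i] n]>>%VS]%classic.
Proof. exact: Der_iddE. Qed.
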